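(* Let $n\in\mathbb{N}$, $\lambda\in[0,\frac{2\pi}{n})$ and $F\in\overline{\mathcal{D}}_{n}(\lambda)$. Then $\Delta_{\lambda}^{n}[F]\in\pi_{n-1}(\overline{\mathbb{D}})$. Furthermore, if $F\in\mathcal{D}_{n}(\lambda)$, then $\Delta_{\lambda}^{n}[F]\in\pi_{n-1}(\mathbb{D})$.
   Context: All polynomials have complex coefficients. $\mathbb{D}$ is the open unit disk, $\overline{\mathbb{D}}$ its closure, $\mathbb{T}$ the unit circle. For $\Omega\subseteq\mathbb{C}$, $\pi_{m}(\Omega)$ is the set of polynomials of degree $m$ all of whose zeros lie in $\Omega$ (so $\pi_0(\Omega)$ is the set of nonzero constants). $\mathcal{T}_{n}(\lambda)$ is the set of polynomials of degree $n$ all of whose zeros lie on $\mathbb{T}$ and such that each pair of zeros (counted with multiplicity) is separated by an angle $>\lambda$; thus $\mathcal{T}_n(0)$ consists of the polynomials of degree $n$ with only simple zeros, all on $\mathbb{T}$. For $\lambda\in(0,\frac{2\pi}{n})$ and a polynomial $F$ write $F_{+}(z)=F(e^{i\lambda/2}z)$, $F_{-}(z)=F(e^{-i\lambda/2}z)$. $\overline{\mathcal{D}}_{n}(\lambda)$ is the set of polynomials $F$ of degree $n$ with $$\operatorname{Im}\Bigl(e^{-in\lambda/2}\frac{F_{+}(z)}{F_{-}(z)}\Bigr)>0\quad\text{for all } z\in\mathbb{C}\setminus\overline{\mathbb{D}},$$ and $\mathcal{D}_{n}(\lambda)$ is the union of $\mathcal{T}_{n}(\lambda)$ with the set of all polynomials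 $F$ of degree $n$ for which the same inequality holds for all $z\in\mathbb{C}\setminus\mathbb{D}$. For $\lambda=0$: $\overline{\mathcal{D}}_{n}(0)=\pi_{n}(\overline{\mathbb{D}})$ and $\mathcal{D}_{n}(0)=\pi_{n}(\mathbb{D})\cup\mathcal{T}_{n}(0)$. For a polynomial $F$ of degree $\le n$ and $\lambda\in(0,\frac{2\pi}{n})$, $$\Delta_{\lambda}^{n}[F](z)=\frac{F_{+}(z)-F_{-}(z)}{2iz\sin\frac{n\lambda}{2}},$$ which is a polynomial of degree $\le n-1$; and $\Delta_{0}^{n}[F]=F'/n$. *)

(* Defs.v *)
From HB Require Import structures.
From mathcomp Require Import all_boot all_order all_algebra.
From mathcomp Require Import all_classical all_reals all_analysis.
From mathcomp Require Import complex.

Set Implicit Arguments.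
Unset Strict Implicit.
Unset Printing Implicit Defensive.

Import Order.TTheory GRing.Theory Num.Theory.

Local Open Scope classical_set_scope.
Local Open Scope ring_scope.
Local Open Scope complex_scope.

Section Definitions.
Variable R : realType.
Implicit Types (n m : nat) (lam t : R) (z w : R[i]) (F : {poly R[i]}).

Definition unit_disk : set R[i] := [set z | `|z| < 1].
Definition closed_unit_disk : set R[i] := [set z | `|z| <= 1].
Definition unit_circle : set R[i] := [set z | `|z| = 1].

(* e^{it} *)
Definition expi t : R[i] := cos t +i* sin t.

(* z |-> F (e^{it} z); thus F_+ and F_- are [rotp (lam / 2) F] and
   [rotp (- (lam / 2)) F]. *)
Definition rotp t F : {poly R[i]} := F \Po (expi t *: 'X).

Definition has_degree m F : Prop := size F = m.+1.

Definition polys_zeros_in m (Omega : set R[i]) : set {poly R[i]} :=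
  [set F | has_degree m F /\ forall z, root F z -> Omega z].

(* For z, w on the unit circle: the angle between z and w exceeds lam.  As all
   pairs of arguments are considered, this concerns the shorter of the two
   arcs, and it fails for z = w as soon as 0 <= lam. *)
Definition separated lam z w : Prop :=
  forall s t : R, z = expi s -> w = expi t -> lam < `|s - t|.

(* The list zs enumerates the zeros of F with multiplicity. *)
Definition T_class n lam : set {poly R[i]} :=
  [set F | has_degree n F /\
    exists zs : seq R[i],
      [/\ F = lead_coef F *: \prod_(z <- zs) ('X - z%:P),
          forall z, z \in zs -> unit_circle z
        & forall i j, (i < j < size zs)%N -> separated lam zs`_i zs`_j]].

(* Im (e^{-in lam/2} F_+(z) / F_-(z)) > 0.  Since w / 0 = 0 in MathComp, this
   entails F_-(z) != 0. *)
Definition im_quotient_pos n lam F z : Prop :=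
  0 < complex.Im (expi (- (n%:R * lam / 2)) *
                  ((rotp (lam / 2) F).[z] / (rotp (- (lam / 2)) F).[z])).

Definition Dbar_class n lam : set {poly R[i]} :=
  if lam == 0 then polys_zeros_in n closed_unit_disk
  else [set F | has_degree n F /\
         forall z, ~ closed_unit_disk z -> im_quotient_pos n lam F z].

Definition D_class n lam : set {poly R[i]} :=
  if lam == 0 then polys_zeros_in n unit_disk `|` T_class n 0
  else T_class n lam `|`
       [set F | has_degree n F /\
         forall z, ~ unit_disk z -> im_quotient_pos n lam F z].

(* F_+ - F_- vanishes at 0, so the division by 'X is exact (see qdiffE). *)
Definition qdiff n lam F : {poly R[i]} :=
  if lam == 0 then n%:R^-1 *: F^`()
  else (2 * 'i * (sin (n%:R * lam / 2))%:C)^-1 *: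
       ((rotp (lam / 2) F - rotp (- (lam / 2)) F) %/ 'X).

Lemma qdiffE n lam F z : lam != 0 -> z != 0 ->
  (qdiff n lam F).[z] =
  (F.[expi (lam / 2) * z] - F.[expi (- (lam / 2)) * z]) /
  (2 * 'i * z * (sin (n%:R * lam / 2))%:C).
Proof.
move=> lam0 z0; rewrite /qdiff (negPf lam0) hornerZ.
set G := rotp _ F - _.
have GX : 'X %| G.
  rewrite -['X]subr0 -polyC0 dvdp_XsubCl /root /G /rotp hornerD hornerN.
  by rewrite !horner_comp !hornerZ !hornerX !mulr0 subrr.
have <- : G.[z] = F.[expi (lam / 2) * z] - F.[expi (- (lam / 2)) * z].
  by rewrite /G /rotp hornerD hornerN !horner_comp !hornerZ !hornerX.
rewrite -[in RHS](divpK GX) hornerM hornerX [2 * 'i * z * _]mulrAC.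
by rewrite -[RHS]mulf_div divff // mulr1 mulrC.
Qed.

End Definitions.

Arguments unit_disk {R}.
Arguments closed_unit_disk {R}.

(* Main.v *)
Require Import Defs.
From HB Require Import structures.
From mathcomp Require Import all_boot all_order all_algebra.
From mathcomp Require Import all_classical all_reals all_analysis.
From mathcomp Require Import complex.
From mathcomp Require Import separable ring lra.
Import Order.TTheory GRing.Theory Num.Theory.
Local Open Scope ring_scope.

(** For [lam = 0] this is the Gauss-Lucas theorem for disks centred at [0].  If
    no zero of [F] has modulus exceeding [|z|] and [F z <> 0], then each term of
    [z * F'(z) / F(z) = sum_j z / (z - z_j)] has real part at least [1/2]
    ([half_plane_of_le_norm]), so the sum cannot vanish and neither can [F' z]
    ([deriv_neq0_of_roots_le]).  Hence a critical point on or outside the unit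
    circle is a zero of [F], in fact a multiple one.  It lies on the circle if
    the zeros are in the closed disk, and it does not exist if they are in the
    open disk or are simple.

    For [lam > 0], a zero [z <> 0] of the difference quotient is a solution of
    [F_+ z = F_- z].  Where the inequality defining the classes holds, [F_- z]
    does not vanish and the quotient [F_+ / F_-] takes the value [1] at [z], so
    that the imaginary part in question is [- sin (n lam / 2)], which is
    negative because [0 < n lam / 2 < pi] ([im_quotient_pos_neq]).

    What remains is a point [z] of the unit circle when all zeros of [F] lie on
    the circle and are separated by more than [lam] ([T_class_rot_neq]).  If
    [F_+ z = F_- z = 0], then [e^{i lam/2} z] and [e^{-i lam/2} z] are two zeros
    whose angular distance is only [lam].  If the common value is nonzero, the
    self-inversive identity [conj (F w) * w^n = const * F w] on the circle
    ([conj_horner_unit_roots]) gives equal [n]-th powers of these two points,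
    that is [sin (n lam / 2) = 0], which was just excluded. *)

(** * Critical points and the moduli of the zeros *)

(** With [u = z / (z - w)] one has [u - 1 = w / (z - w)], so the hypothesis reads
    [|u - 1| <= |u|], which describes the half-plane [1/2 <= Re u]; the
    conclusion states this as a bound on [u + u^* = 2 Re u]. *)
Lemma half_plane_of_le_norm (C : numClosedFieldType) (z w : C) :
  `|w| <= `|z| -> z != w -> 1 <= z / (z - w) + (z / (z - w))^*.
Proof.
move=> le_wz neq_zw; have nz : z - w != 0 by rewrite subr_eq0.
have : `|z / (z - w) - 1| ^+ 2 <= `|z / (z - w)| ^+ 2.
  have -> : z / (z - w) - 1 = w / (z - w) by field.
  by rewrite lerXn2r ?nnegrE ?normr_ge0 // !normf_div ler_wpM2r ?invr_ge0.
set u := z / (z - w); rewrite !normCK rmorphB rmorph1 => le_u.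
rewrite -subr_ge0; move: le_u; rewrite -subr_ge0 => le_u.
rewrite (_ : _ - 1 = u * u^* - (u - 1) * (u^* - 1)) //; ring.
Qed.

(** The logarithmic derivative turns the product over the zeros into a sum of
    terms, each of which lies in the half-plane of [half_plane_of_le_norm]. *)
Lemma log_derivative_ge (C : numClosedFieldType) (zs : seq C) (z : C)
    (p := \prod_(w <- zs) ('X - w%:P)) (L := z * p^`().[z] / p.[z]) :
  {in zs, forall w, `|w| <= `|z|} -> p.[z] != 0 -> (size zs)%:R <= L + L^*.
Proof.
rewrite {}/L {}/p; elim: zs => [|w zs IH] le_zs.
  rewrite big_nil derivC horner0 mulr0 mul0r.
  by rewrite conjC0 addr0.
rewrite big_cons; set q := \prod_(j <- zs) _.
rewrite derivM derivXsubC !hornerE mulf_eq0 negb_or => /andP[nzw nq].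
have -> : z * (q.[z] + (z - w) * q^`().[z]) / ((z - w) * q.[z]) =
          z / (z - w) + z * q^`().[z] / q.[z] by field; rewrite nzw nq.
rewrite rmorphD addrACA /= -nat1r lerD //.
  apply: half_plane_of_le_norm; first by apply: le_zs; rewrite mem_head.
  by rewrite -subr_eq0.
by apply: IH nq => v v_zs; apply: le_zs; rewrite inE v_zs orbT.
Qed.

Lemma size_deriv_numDomain (C : numDomainType) (p : {poly C}) :
  size p^`() = (size p).-1.
Proof.
have [/size1_polyC -> | p_gt1] := leqP (size p) 1.
  by rewrite derivC size_poly0 size_polyC; case: (_ == 0).
rewrite /deriv size_poly_eq // mulrn_eq0 /= prednK.
  by rewrite -lead_coefE lead_coef_eq0 -size_poly_eq0; case: size p_gt1.
by rewrite -subn1 subn_gt0.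
Qed.

(** The strong form of the Gauss-Lucas theorem for disks centred at the origin:
    a critical point on the circle through the outermost zeros must itself be a
    zero, because twice the real part of [z * F'(z) / F(z)] is otherwise at least
    the degree. *)
Lemma deriv_neq0_of_roots_le (C : numClosedFieldType) (F : {poly C}) (z : C) :
  (1 < size F)%N -> (forall w, root F w -> `|w| <= `|z|) -> ~~ root F z ->
  ~~ root F^`() z.
Proof.
have [zs ->] := closed_field_poly_normal F; set c := lead_coef F.
have [-> | c0] := eqVneq c 0; first by rewrite scale0r size_poly0.
rewrite size_scale // size_prod_XsubC ltnS derivZ => zs_gt0.
move=> le_zs; rewrite !rootZ // => nz; apply/negP => /rootP d0.
have le_zs' : {in zs, forall w, `|w| <= `|z|}.
  by move=> w w_zs; apply: le_zs; rewrite rootZ ?root_prod_XsubC.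
have := log_derivative_ge C zs z le_zs' nz.
by rewrite d0 mulr0 mul0r conjC0 addr0 lern0 -leqn0 leqNgt zs_gt0.
Qed.

(** * Values on the unit circle of a polynomial with all zeros there *)

(** Self-inversiveness.  For [w] and [z] on the circle, conjugation is inversion,
    so [(w - z)^* * w = 1 - z^* * w = - z^* * (w - z)]; the identity is the
    product of these over the zeros. *)
Lemma conj_horner_unit_roots (C : numClosedFieldType) (zs : seq C) (w : C)
    (p := \prod_(z <- zs) ('X - z%:P)) :
  `|w| = 1 -> {in zs, forall z, `|z| = 1} ->
  p.[w]^* * w ^+ size zs = (\prod_(z <- zs) - z^*) * p.[w].
Proof.
rewrite {}/p => w1; elim: zs => [|z zs IH] zs1.
  by rewrite !big_nil hornerC rmorph1.
rewrite !big_cons !hornerE rmorphM rmorphB /= exprS.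
have conjK (x : C) : `|x| = 1 -> x^* * x = 1.
  by move=> x1; rewrite mulrC -normCK x1 expr1n.
rewrite mulrACA IH; last by move=> v vzs; rewrite zs1 // inE vzs orbT.
rewrite -[RHS]mulrA [RHS]mulrACA; congr (_ * _).
have z1 : `|z| = 1 by rewrite zs1 ?mem_head.
by rewrite mulrBl mulNr mulrBr opprB (conjK w) // (conjK z).
Qed.

(** Equal nonzero values cancel in the self-inversive identity, which leaves the
    powers of the two points. *)
Lemma expn_eq_of_horner_eq (C : numClosedFieldType) (zs : seq C) (v w : C)
    (p := \prod_(z <- zs) ('X - z%:P)) :
  `|v| = 1 -> `|w| = 1 -> {in zs, forall z, `|z| = 1} ->
  p.[v] = p.[w] -> p.[w] != 0 -> v ^+ size zs = w ^+ size zs.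
Proof.
move=> v1 w1 zs1 eq_vw nz.
have nz' : p.[w]^* != 0 by rewrite conjC_eq0.
apply: (mulfI nz'); rewrite -{1}eq_vw.
by rewrite !conj_horner_unit_roots // -/p eq_vw.
Qed.

(** * The points [e^{it}] *)

Section Expi.
Variable R : realType.
Implicit Types (s t lam : R) (z : R[i]).

Lemma expiD s t : expi (s + t) = expi s * expi t.
Proof.
apply/eqP; rewrite eq_complex /= cosD sinD.
by rewrite eqxx addrC eqxx.
Qed.

Lemma expi0 : expi (0 : R) = 1.
Proof. by rewrite /expi cos0 sin0. Qed.

Lemma expiX t n : expi t ^+ n = expi (n%:R * t).
Proof.
elim: n => [|n IH]; first by rewrite mul0r expi0.
by rewrite exprS IH -expiD -natr1 mulrDl mul1r addrC.
Qed.

Lemma norm_expi t : `|expi t| = 1.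
Proof. by rewrite normc_def /= cos2Dsin2 sqrtr1. Qed.

Lemma two_i_sin_neq0 t : sin t != 0 -> 2 * 'i * (sin t)%:C%C != 0 :> R[i].
Proof. by move=> t0; rewrite !mulf_neq0 ?pnatr_eq0 ?neq0Ci // fmorph_eq0. Qed.

Lemma expi_sub_expiN t : expi t - expi (- t) = 2 * 'i * (sin t)%:C%C.
Proof.
rewrite /expi cosN sinN -complexiE; apply/eqP.
by rewrite eq_complex /= ; apply/andP; split; apply/eqP; ring.
Qed.

(** [acos] only yields arguments of the upper half circle, hence the sign. *)
Lemma unit_eq_expi z : `|z| = 1 -> exists t, z = expi t.
Proof.
case: z => x y; rewrite normc_def /= => /(congr1 (@complex.Re R)) /= n1.
have xy1 : x ^+ 2 + y ^+ 2 = 1.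
  by rewrite -[LHS]sqr_sqrtr ?addr_ge0 ?sqr_ge0 // n1 expr1n.
have x1 : -1 <= x <= 1 by apply/andP; split; nra.
have sy : sin (acos x) = `|y|.
  by rewrite sin_acos // -xy1 addrAC subrr add0r sqrtr_sqr.
have cx : cos (acos x) = x by apply: acosK; rewrite in_itv.
have [y0 | y0] := lerP 0 y.
  by exists (acos x); rewrite /expi cx sy ger0_norm.
by exists (- acos x); rewrite /expi cosN sinN cx sy ltr0_norm // opprK.
Qed.

(** The existence of an argument matters here: without one, separation would hold
    vacuously. *)
Lemma separated_neq lam z w :
  0 <= lam -> `|z| = 1 -> Defs.separated lam z w -> z != w.
Proof.
move=> lam0 /unit_eq_expi[t zt] sep; apply/eqP => zw.
by have := sep t t zt; rewrite -zw => /(_ zt); rewrite subrr normr0 ltNge lam0.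
Qed.

Lemma separated_rot lam z
    (w1 := expi (lam / 2) * z) (w2 := expi (- (lam / 2)) * z) :
  0 <= lam -> `|z| = 1 ->
  ~ Defs.separated lam w1 w2 /\ ~ Defs.separated lam w2 w1.
Proof.
rewrite {}/w1 {}/w2 => lam0 /unit_eq_expi[t ->]; rewrite -!expiD.
have gap : `|lam / 2 + t - (- (lam / 2) + t)| = lam.
  by rewrite -[RHS](ger0_norm lam0); congr `|_|; field.
split=> /(_ _ _ erefl erefl); first by rewrite gap ltxx.
by rewrite distrC gap ltxx.
Qed.

Lemma horner_rotp t (F : {poly R[i]}) z : (rotp t F).[z] = F.[expi t * z].
Proof. by rewrite /rotp horner_comp !hornerE. Qed.

Lemma coef_rotp t (F : {poly R[i]}) k : (rotp t F)`_k = F`_k * expi (k%:R * t).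
Proof.
rewrite /rotp comp_polyE -expiX.
under eq_bigr => i _ do rewrite exprZn scalerA.
rewrite -(poly_def (size F) (fun i => F`_i * expi t ^+ i)) coef_poly.
by case: ltnP => // /(nth_default 0) ->; rewrite mul0r.
Qed.

End Expi.

(** * Zeros of the difference quotient *)

Section QDiff.
Variables (R : realType) (n : nat) (lam : R).
Implicit Types (F : {poly R[i]}) (z : R[i]).

Lemma sin_nlam_gt0 :
  (0 < n)%N -> 0 < lam -> lam < 2 * pi / n%:R -> 0 < sin (n%:R * lam / 2).
Proof.
move=> n_gt0 lam0; have n0 : 0 < n%:R :> R by rewrite ltr0n.
rewrite ltr_pdivlMr // => lam_lt; apply: sin_gt0_pi.
rewrite divr_gt0 ?mulr_gt0 //= ltr_pdivrMr //.
by rewrite mulrC [pi * 2]mulrC.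
Qed.

(** The coefficient of [F_+ - F_-] at ['X^n] is that of [F] multiplied by
    [2 i sin (n lam / 2)], so the degree drops only through the division by
    ['X]. *)
Lemma size_qdiff F : lam != 0 -> sin (n%:R * lam / 2) != 0 -> (0 < n)%N ->
  has_degree n F -> has_degree n.-1 (qdiff n lam F).
Proof.
move=> lam_neq0 sin_neq0 n_gt0; rewrite /has_degree => sF.
rewrite prednK // /qdiff (negPf lam_neq0).
have c0 := two_i_sin_neq0 _ _ sin_neq0.
rewrite size_scale ?invr_neq0 // size_divp ?polyX_eq0 // size_polyX subn1.
suff -> : size (rotp (lam / 2) F - rotp (- (lam / 2)) F) = n.+1 by [].
apply/eqP; rewrite eqn_leq; apply/andP; split.
  apply/leq_sizeP => j le_nj; rewrite coefB !coef_rotp.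
  by rewrite nth_default ?sF // !mul0r subrr.
rewrite ltnNge; apply/negP => /leq_sizeP/(_ n (leqnn n))/eqP.
rewrite coefB !coef_rotp -mulrBr mulrN mulrA expi_sub_expiN mulf_eq0.
rewrite (negPf c0) orbF => /eqP Fn0.
have : lead_coef F != 0 by rewrite lead_coef_eq0 -size_poly_eq0 sF.
by rewrite lead_coefE sF Fn0 eqxx.
Qed.

Lemma root_qdiff F z : lam != 0 -> sin (n%:R * lam / 2) != 0 -> z != 0 ->
  root (qdiff n lam F) z ->
  F.[expi (lam / 2) * z] = F.[expi (- (lam / 2)) * z].
Proof.
move=> lam_neq0 sin_neq0 z0 /rootP; rewrite qdiffE // => /eqP.
rewrite mulf_eq0 invr_eq0 [2 * 'i * z * _]mulrAC mulf_eq0 (negPf z0).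
by rewrite (negPf (two_i_sin_neq0 _ _ sin_neq0)) !orbF subr_eq0 => /eqP.
Qed.

(** The common value cannot be [0] either: division by zero returns [0], whose
    imaginary part is not positive. *)
Lemma im_quotient_pos_neq F z : 0 < sin (n%:R * lam / 2) ->
  im_quotient_pos n lam F z ->
  F.[expi (lam / 2) * z] <> F.[expi (- (lam / 2)) * z].
Proof.
move=> sin_gt0; rewrite /im_quotient_pos !horner_rotp => im_pos eqF.
move: im_pos; rewrite eqF.
have [-> | nz] := eqVneq F.[expi (- (lam / 2)) * z] 0.
  by rewrite mul0r mulr0 ltxx.
by rewrite divff // mulr1 /= sinN oppr_gt0 ltNge (ltW sin_gt0).
Qed.

(** Either both rotated points are zeros of [F], too close to each other, or
    self-inversiveness makes their [n]-th powers agree.  The latter also settles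
    the degenerate case in which they coincide. *)
Lemma T_class_rot_neq F z : 0 < lam -> sin (n%:R * lam / 2) != 0 ->
  T_class n lam F -> `|z| = 1 ->
  F.[expi (lam / 2) * z] <> F.[expi (- (lam / 2)) * z].
Proof.
move=> lam_gt0 sin_neq0 [sF [zs [Fzs zs1 sep]]] z1.
have c0 : lead_coef F != 0 by rewrite lead_coef_eq0 -size_poly_eq0 sF.
have szs : size zs = n.
  by apply: succn_inj; rewrite -sF Fzs size_scale // size_prod_XsubC.
set w1 := _ * z; set w2 := (X in _ <> _.[X]).
have w1z : `|w1| = 1 by rewrite normrM norm_expi z1 mulr1.
have w2z : `|w2| = 1 by rewrite normrM norm_expi z1 mulr1.
have nz : z != 0 by rewrite -normr_eq0 z1 oner_eq0.
rewrite Fzs !hornerZ => /(mulfI c0) eqw.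
have powN : w1 ^+ n <> w2 ^+ n.
  rewrite !exprMn => /(mulIf (expf_neq0 n nz))/eqP.
  rewrite !expiX mulrN -subr_eq0 mulrA expi_sub_expiN.
  by rewrite (negPf (two_i_sin_neq0 _ _ sin_neq0)).
have [r2 | r2] := eqVneq (\prod_(z <- zs) ('X - z%:P)).[w2] 0; last first.
  by apply: powN; rewrite -szs; apply: expn_eq_of_horner_eq eqw r2.
have w2_zs : w2 \in zs by rewrite -root_prod_XsubC; apply/rootP.
have w1_zs : w1 \in zs by rewrite -root_prod_XsubC; apply/rootP; rewrite eqw.
have [s12 s21] := separated_rot R lam z (ltW lam_gt0) z1.
have [lt12 | lt21 | /(congr1 (nth 0 zs))] := ltngtP (index w1 zs) (index w2 zs).
- by apply: s12; have := sep (index w1 zs) (index w2 zs);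
    rewrite !nth_index // index_mem lt12 w2_zs; apply.
- by apply: s21; have := sep (index w2 zs) (index w1 zs);
    rewrite !nth_index // index_mem lt21 w1_zs; apply.
by rewrite !nth_index // => w12; apply: powN; rewrite w12.
Qed.

End QDiff.

(** Separated zeros are pairwise distinct, so [F] is a separable polynomial. *)
Lemma T_class0_simple (R : realType) (n : nat) (F : {poly R[i]}) (z : R[i]) :
  T_class n 0 F -> root F z -> ~~ root F^`() z.
Proof.
move=> [sF [zs [Fzs zs1 sep]]].
have c0 : lead_coef F != 0 by rewrite lead_coef_eq0 -size_poly_eq0 sF.
have neq i j : (i < j < size zs)%N -> zs`_i != zs`_j.
  move=> /[dup] ij /andP[lt_ij lt_j].
  apply: (@separated_neq R 0) (sep _ _ ij) => //.
  exact/zs1/mem_nth/(ltn_trans lt_ij).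
have zs_uniq : uniq zs.
  apply/(uniqP 0) => i j; rewrite !inE => lt_i lt_j eq_ij.
  have [lt | lt | //] := ltngtP i j.
    by have := neq i j; rewrite lt lt_j eq_ij eqxx => /(_ isT).
  by have := neq j i; rewrite lt lt_i eq_ij eqxx => /(_ isT).
move: zs_uniq; rewrite -separable_prod_XsubC unlock => cop.
rewrite Fzs derivZ !rootZ // => r.
by apply: coprimep_root cop r.
Qed.

Theorem theorem11 (R : realType) (n : nat) (lam : R) (F : {poly R[i]})
    (n_gt0 : (0 < n)%N) (lam_ge0 : 0 <= lam) (lam_lt : lam < 2 * pi / n%:R)
    (F_Dbar : Dbar_class n lam F) :
  polys_zeros_in n.-1 closed_unit_disk (qdiff n lam F) /\
  (D_class n lam F ->
     polys_zeros_in n.-1 unit_disk (qdiff n lam F)).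
Proof.
have [lam0 | lam_neq0] := eqVneq lam 0.
  move: F_Dbar; rewrite /Dbar_class /D_class /qdiff lam0 eqxx => -[sF le1].
  have nV0 : n%:R^-1 != 0 :> R[i] by rewrite invr_eq0 pnatr_eq0 -lt0n.
  have deg : has_degree n.-1 (n%:R^-1 *: F^`()).
    by rewrite /has_degree size_scale // size_deriv_numDomain sF prednK.
  have sF1 : (1 < size F)%N by rewrite sF.
  have crit z : 1 <= `|z| -> root (n%:R^-1 *: F^`()) z -> root F z.
    move=> z1; rewrite rootZ //; apply: contraLR.
    by apply: deriv_neq0_of_roots_le => // w /le1 w1; apply: le_trans w1 z1.
  split.
    split=> // z dz; rewrite /closed_unit_disk /=.
    rewrite real_leNgt ?realE ?normr_ge0 ?ler01 //; apply/negP => z1.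
    have /le1 := crit z (ltW z1) dz.
    by rewrite /closed_unit_disk /= (lt_geF z1).
  move=> FD; split=> // z dz; rewrite /unit_disk /=.
  rewrite real_ltNge ?realE ?normr_ge0 ?ler01 //; apply/negP => z1.
  have Fz := crit z z1 dz.
  case: FD => [[_ /(_ _ Fz)] | FT]; first by rewrite /unit_disk /= (le_gtF z1).
  by have := T_class0_simple R n F z FT Fz; move: dz; rewrite rootZ // => ->.
have lam_gt0 : 0 < lam by rewrite lt_def lam_neq0.
have sin_gt0 := sin_nlam_gt0 R n lam n_gt0 lam_gt0 lam_lt.
have sin_neq0 := lt0r_neq0 sin_gt0.
move: F_Dbar; rewrite /Dbar_class /D_class (negPf lam_neq0) => -[sF im_pos].
have deg := size_qdiff R n lam F lam_neq0 sin_neq0 n_gt0 sF.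
have in_closed z : root (qdiff n lam F) z -> `|z| <= 1.
  move=> dz; rewrite real_leNgt ?realE ?normr_ge0 ?ler01 //; apply/negP => z1.
  have z0 : z != 0 by rewrite -normr_gt0 (lt_trans ltr01 z1).
  apply: (im_quotient_pos_neq _ _ _ _ _ sin_gt0 (im_pos z _)).
    by rewrite /closed_unit_disk /= (lt_geF z1).
  exact: root_qdiff dz.
split; first by [].
move=> FD; split=> // z dz.
apply: contrapT => /[dup] nz; rewrite /unit_disk /= => /negP.
have z1 := in_closed z dz.
rewrite lt_neqAle z1 andbT negbK => /eqP z_unit.
have z0 : z != 0 by rewrite -normr_gt0 z_unit ltr01.
have eqF := root_qdiff _ _ _ _ _ lam_neq0 sin_neq0 z0 dz.
case: FD => [FT | [_ im_posD]]; last first.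
  exact: (im_quotient_pos_neq _ _ _ _ _ sin_gt0 (im_posD z nz) eqF).
exact: (T_class_rot_neq _ _ _ _ _ lam_gt0 sin_neq0 FT z_unit eqF).
Qed.
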